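(* Let $n\ge 4$ and let $w\in W(D_n)$ be bad. Then $w=w_m u$ with $\ell(w)=\ell(w_m)+\ell(u)$ for some integer $m$ with $0\le m\le n$, where $u$ is a product of mutually commuting generators with $\operatorname{supp}(u)\subseteq\{s_{m+2},s_{m+3},\dots,s_n\}$.
   Context: $W(D_n)$ is the Coxeter group with generators $s_1,\dots,s_n$, where $s_1s_3$, $s_2s_3$, $s_is_{i+1}$ ($3\le i\le n-1$) have order 3 and all other pairs of distinct generators commute. It is realized as the group of signed permutations $\sigma$ of $\{\pm1,\dots,\pm n\}$ ($\sigma(-a)=-\sigma(a)$) with an even number of $i\in\{1,\dots,n\}$ having $\sigma(i)<0$, via $s_1\mapsto(1,-2)(-1,2)$ and $s_i\mapsto(i-1,i)(-(i-1),-i)$ for $i\ge2$; products are compositions of functions, and $w$ is written in one-line notation $(w(1),\dots,w(n))$. An element $w$ is bad if it is not a product of mutually commuting generators and no reduced expression of $w$ begins or ends with two noncommuting generators. $\operatorname{supp}(u)$ is the set of generators appearing in a reduced expression of $u$. For even $m$ with $0\le m\le n$, $w_m\in W(D_n)$ is defined by $w_m(1)=(-1)^{m/2}$ (if $m\ge 1$), $w_m(i)=i$ for odd $i$ with $1<i\le m$, $w_m(i)=-(m+2-i)$ for even $i\le m$, and $w_m(i)=i$ for $i>m$ (so $w_0$ is the identity); for odd $m$, $w_m=w_{m-1}$. *)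

(* Defs.v *)
From mathcomp Require Import all_boot all_fingroup.

Set Implicit Arguments.
Unset Strict Implicit.
Unset Printing Implicit Defensive.

Local Open Scope group_scope.

(* (b, i) encodes the integer i + 1 if b = false, and - (i + 1) if b = true. *)
Notation pt n := (bool * 'I_n)%type.

Definition ptneg n (a : pt n) : pt n := (~~ a.1, a.2).

(* The default i is only returned when k is not smaller than n. *)
Definition ord_near n (i : 'I_n) (k : nat) : 'I_n := insubd i k.

(* Products of permutations in MathComp apply the left factor first;
   mulc v w is the composite sending a to v (w a). *)
Definition mulc (T : finType) (v w : {perm T}) : {perm T} := w * v.

Definition WD n : {set {perm pt n}} :=
  [set w : {perm pt n} | [forall a, w (ptneg a) == ptneg (w a)]
         & ~~ odd #|[set i : 'I_n | (w (false, i)).1]|].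

(* sgen i is the generator s_(i+1): the index i : 'I_n starts at 0. *)
Definition sgen n (i : 'I_n) : {perm pt n} :=
  let: (a, b) := if i == 0 :> nat then ((false, i), (true, ord_near i 1))
                 else ((false, ord_near i i.-1), (false, i)) in
  mulc (tperm a b) (tperm (ptneg a) (ptneg b)).

Definition word n (s : seq 'I_n) : {perm pt n} :=
  foldr (fun i w => mulc (sgen i) w) 1 s.

Section Generation.

Variable n : nat.
Implicit Types (a : pt n) (i j k l : 'I_n) (v w : {perm pt n}).

Let ptnegK : involutive (@ptneg n).
Proof. by case=> b i; rewrite /ptneg /= negbK. Qed.

Let parity w := \big[addb/false]_(i : 'I_n) (w (false, i)).1.

Lemma WDP w : reflect ((forall a, w (ptneg a) = ptneg (w a)) /\ ~~ parity w)
  (w \in WD n).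
Proof.
have -> : parity w = odd #|[set i : 'I_n | (w (false, i)).1]|.
  rewrite -sum1_card (big_morph odd oddD (erefl : odd 0 = false)) big_mkcond.
  by apply: eq_bigr => i _; rewrite inE; case: (w _).1.
rewrite inE; apply: (iffP andP) => -[h ->]; split=> //.
  by move=> a; apply/eqP; have /forallP := h.
by apply/forallP=> a; rewrite h.
Qed.

Lemma WD_group_set : group_set (WD n).
Proof.
apply/group_setP; split=> [|v w /WDP[hv pv] /WDP[hw pw]].
  by apply/WDP; split=> [a|]; rewrite ?perm1 // /parity big1 // => i _; rewrite perm1.
apply/WDP; split=> [a|]; first by rewrite !permM hv hw.
have inj : injective (fun i => (v (false, i)).2).
  move=> i j; case Ei: (v (false, i)) => [b x]; case Ej: (v (false, j)) => [c y] /= e.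
  subst y; case: (eqVneq b c) Ej => [<-|bc] Ej.
    by have /perm_inj[] : v (false, i) = v (false, j) by rewrite Ei Ej.
  have /perm_inj // : v (false, i) = v (ptneg (false, j)).
  by rewrite hv Ei Ej /ptneg /=; case: b c bc {Ei Ej} => [] [].
have -> : parity (v * w) = parity v (+) parity w.
  rewrite {3}/parity (reindex_inj inj) /= -big_split /=.
  apply: eq_bigr => i _; rewrite permM.
  case: (v (false, i)) => [[] x] //=.
  by rewrite -[(true, x)]/(ptneg (false, x)) hw /=; case: (w _).1.
by rewrite (negbTE pv) (negbTE pw).
Qed.

Canonical WD_group := Group WD_group_set.

Lemma ord_nearE i (k : nat) : k < n -> ord_near i k = k :> nat.
Proof. by move=> kn; rewrite /ord_near val_insubd kn. Qed.

Let G : {group {perm pt n}} := <<[set sgen i | i : 'I_n]>>%G.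

Let sgenG i : sgen i \in G. Proof. by rewrite mem_gen // imset_f. Qed.

Lemma sgenS i j (a : pt n) : i = j.+1 :> nat ->
  sgen i a = (a.1, if a.2 == i then j else if a.2 == j then i else a.2).
Proof.
move=> ij; rewrite /sgen ij /= /mulc !permM.
have -> : ord_near i j = j by apply: ord_inj; rewrite ord_nearE ?ltn_ord.
have nij : (i == j) = false by rewrite -val_eqE /= ij eqn_leq ltnn.
case: a => b c; rewrite /ptneg /=.
case: (eqVneq c i) => [->|/negbTE ci]; last case: (eqVneq c j) => [->|/negbTE cj];
  by case: b; do 2!rewrite permE /= ?xpair_eqE ?eqxx ?nij ?(eq_sym j) ?nij ?ci ?cj /=.
Qed.

Lemma sgen0 i j (a : pt n) : i = 0 :> nat -> j = 1%N :> nat ->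
  sgen i a = if a.2 == i then (~~ a.1, j) else if a.2 == j then (~~ a.1, i) else a.
Proof.
move=> i0 j1; rewrite /sgen i0 /= /mulc !permM.
have -> : ord_near i 1 = j by apply: ord_inj; rewrite ord_nearE -j1 ?ltn_ord.
have nij : (i == j) = false by rewrite -val_eqE /= i0 j1.
case: a => b c; rewrite /ptneg /=.
case: (eqVneq c i) => [->|/negbTE ci]; last case: (eqVneq c j) => [->|/negbTE cj];
  by case: b; do 2!rewrite permE /= ?xpair_eqE ?eqxx ?nij ?(eq_sym j) ?nij ?ci ?cj /=;
    rewrite ?xpair_eqE ?eqxx ?nij ?(eq_sym j) ?nij ?ci ?cj.
Qed.

Let sgen_WD i : sgen i \in WD n.
Proof.
apply/WDP; case: i => [[|k] lt_kn]; set i := Ordinal _.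
  have [n_gt1|n_le1] := ltnP 1 n; last first.
    have -> : sgen i = 1.
      apply/permP=> a; rewrite perm1 /sgen /= /mulc permM /ptneg /=.
      have -> : ord_near i 1 = i.
        by rewrite /ord_near /insubd insubF // ltnNge n_le1.
      by rewrite (tpermC (true, i)) tpermK.
    by split=> [a|]; rewrite ?perm1 // /parity big1 // => j _; rewrite perm1.
  pose j := Ordinal n_gt1; have sE a := @sgen0 i j a erefl erefl.
  split=> [[b c]|]; first by rewrite !sE /=; do 2?case: ifP => _ /=.
  rewrite /parity (bigD1 i) //= (bigD1 j) //= big1 => [|c /andP[ci cj]].
    by rewrite !sE /= ?eqxx.
  by rewrite sE /= (negbTE ci) (negbTE cj).
pose j := Ordinal (ltnW lt_kn); have sE a := @sgenS i j a erefl.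
by split=> [[b c]|]; rewrite ?sE // /parity big1 // => c _; rewrite sE.
Qed.

Let to0 (b : bool) i (m : nat) : i <= m -> forall z : 'I_n, z = 0 :> nat ->
  exists2 g, g \in G & g (b, i) = (b, z) /\
    forall c k, m < k -> g (c, k) = (c, k).
Proof.
move=> im z z0; case: i im => x lt_xn /= xm.
elim: x lt_xn xm => [|x IH] lt_xn xm.
  exists 1; rewrite ?group1 //; split=> [|c k _]; rewrite perm1 //.
  by congr pair; apply: ord_inj.
have [g gG [gx gm]] := IH (ltnW lt_xn) (ltnW xm).
exists (sgen (Ordinal lt_xn) * g); first by rewrite groupM.
split=> [|c k mk]; rewrite permM (@sgenS (Ordinal lt_xn) (Ordinal (ltnW lt_xn)) _ erefl) /= ?eqxx //.
have xk : x.+1 < k := leq_ltn_trans xm mk.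
by rewrite -!val_eqE /= (gtn_eqF xk) (gtn_eqF (ltnW xk)) gm.
Qed.

Let to_top (b : bool) i k : 0 < k -> i <= k ->
  exists2 g, g \in G & g (b, i) = (false, k) /\
    forall c l, k < l -> g (c, l) = (c, l).
Proof.
move=> k0 ik; have n0 : 0 < n := leq_ltn_trans (leq0n _) (ltn_ord k).
pose z := Ordinal n0.
have [g gG [gi gk]] := to0 b ik (erefl : z = 0 :> nat).
have [h hG [hk hl]] := to0 false (leqnn k) (erefl : z = 0 :> nat).
have n1 : 1 < n := leq_ltn_trans k0 (ltn_ord k).
pose o := Ordinal n1.
have [p pG [po pl]] := to0 false (k0 : o <= k) (erefl : z = 0 :> nat).
have sE a := @sgen0 z o a erefl erefl.
have fixV (q : {perm pt n}) : (forall c l, k < l -> q (c, l) = (c, l)) ->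
    forall c l, k < l -> q^-1 (c, l) = (c, l).
  by move=> qE c l kl; rewrite -{1}(qE c l kl) permK.
case: b g gG gi gk => g gG gi gk.
  exists (g * sgen z * p * h^-1); first by rewrite groupM ?groupV // groupM // groupM ?sgenG.
  split=> [|c l kl]; first by rewrite 3!permM gi sE /= po -hk permK.
  have l1 : 1 < l := leq_ltn_trans k0 kl.
  by rewrite 3!permM gk // sE -!val_eqE /= (gtn_eqF l1) (gtn_eqF (ltnW l1)) pl ?fixV.
exists (g * h^-1); first by rewrite groupM ?groupV.
split=> [|c l kl]; first by rewrite permM gi -hk permK.
by rewrite permM gk // fixV.
Qed.

Lemma WD_gen : WD n = <<[set sgen i | i : 'I_n]>>.
Proof.
apply/eqP; rewrite eqEsubset gen_subG andbC; apply/andP; split.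
  by apply/subsetP=> _ /imsetP[i _ ->]; apply: sgen_WD.
have sGW : G \subset WD n.
  by rewrite gen_subG; apply/subsetP=> _ /imsetP[i _ ->]; apply: sgen_WD.
apply/subsetP=> w; suff: forall m : nat, m <= n -> forall w, w \in WD n ->
    (forall i, m <= i -> w (false, i) = (false, i)) -> w \in G.
  by move=> /(_ n (leqnn n) w) H wW; apply: H wW _ => i; rewrite leqNgt ltn_ord.
elim=> [_|m IH mn] {}w wW wfix; have /WDP[wneg wpar] := wW.
  suff -> : w = 1 by rewrite group1.
  apply/permP=> -[[] i]; rewrite perm1; last exact: wfix.
  by rewrite -[(true, i)]/(ptneg (false, i)) wneg wfix.
pose k := Ordinal mn; case Ek: (w (false, k)) => [b j].
have jk : j <= k.
  rewrite leqNgt; apply/negP=> kj.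
  have wj := wfix j kj.
  have /perm_inj[] : w (false, k) = w (b, j).
    by rewrite Ek; case: b {Ek} => //; rewrite -[(true, j)]/(ptneg (false, j)) wneg wj.
  by move=> _ ekj; rewrite ekj ltnn in kj.
have [k0|k0] := posnP k.
  apply: IH => //; first exact: ltnW.
  move=> i; rewrite leq_eqVlt => /predU1P[ki|]; last exact: wfix.
  have -> : i = k by apply: ord_inj.
  have ejk : j = k by apply: ord_inj; apply/eqP; rewrite eqn_leq jk k0.
  move: wpar; rewrite /parity (bigD1 k) //= big1 => [|l lk].
    by rewrite Ek ejk; case: b {Ek}.
  rewrite wfix //= ltn_neqAle -[m]/(k : nat) {2}k0 leq0n andbT.
  by rewrite eq_sym.
have [g gG [gj gk]] := to_top b k0 jk.
rewrite -(groupMr _ gG); apply: IH; first exact: ltnW.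
  by rewrite groupM // (subsetP sGW).
move=> i; rewrite leq_eqVlt => /predU1P[ki|ki]; rewrite permM.
  by have -> : i = k; [apply: ord_inj | rewrite Ek gj].
by rewrite wfix // gk.
Qed.

End Generation.

Lemma word_exists n (w : {perm pt n}) :
  exists k, (w \in WD n) ==> [exists t : k.-tuple 'I_n, word t == w].
Proof.
have [|wW] := boolP (w \in WD n); last by exists 0.
rewrite WD_gen => /gen_prodgP[k [c cG ->]].
suff [s <-] : exists s : seq 'I_n, word s = \prod_(i < k) c i.
  by exists (size s); apply/existsP; exists (in_tuple s).
elim: k c cG => [|k IH] c cG; first by exists [::]; rewrite big_ord0.
have [s sE] := IH (fun i => c (widen_ord (leqnSn k) i)) (fun i => cG _).
have /imsetP[i _ iE] := cG ord_max.
by exists (i :: s); rewrite /= /mulc sE -iE big_ord_recr.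
Qed.

(* Meaningful on WD n only; elsewhere the value is 0. *)
Definition len n (w : {perm pt n}) : nat := ex_minn (word_exists w).

Definition reduced_expr n (s : seq 'I_n) (w : {perm pt n}) : bool :=
  (word s == w) && (size s == len w).

Definition supp n (w : {perm pt n}) : {set 'I_n} :=
  [set i | [exists t : (len w).-tuple 'I_n, reduced_expr t w && (i \in t)]].

Definition commuting_product n (w : {perm pt n}) : Prop :=
  exists2 s : seq 'I_n,
    {in s &, forall i j, commute (sgen i) (sgen j)} & word s = w.

Definition begins_noncommuting n (s : seq 'I_n) : Prop :=
  exists i j (t : seq 'I_n), ~ commute (sgen i) (sgen j) /\ s = [:: i, j & t].

Definition ends_noncommuting n (s : seq 'I_n) : Prop :=
  exists i j (t : seq 'I_n), ~ commute (sgen i) (sgen j) /\ s = t ++ [:: i; j].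

Definition bad n (w : {perm pt n}) : Prop :=
  ~ commuting_product w /\
  forall s, reduced_expr s w -> ~ begins_noncommuting s /\ ~ ends_noncommuting s.

(* |w_m(i)| and the sign of w_m(i), for i >= 1 and m even *)
Definition wm_abs (m i : nat) : nat :=
  if ~~ odd i && (i <= m) then m + 2 - i else i.

Definition wm_neg (m i : nat) : bool :=
  if i == 1%N then odd m./2 else ~~ odd i && (i <= m).

(* m./2.*2 is m for even m and m.-1 for odd m. *)
Definition wm_fun n (m : nat) (a : pt n) : pt n :=
  let e := m./2.*2 in
  (a.1 (+) wm_neg e a.2.+1, ord_near a.2 (wm_abs e a.2.+1).-1).

Lemma wm_fun_inj n m : injective (@wm_fun n m).
Proof.
apply: inv_inj => -[b j]; rewrite /wm_fun /=.
set e := m./2.*2; have eo : odd e = false by rewrite /e odd_double.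
pose k := ord_near j (wm_abs e j.+1).-1; rewrite -/k.
suff [kE sE] : ord_near k (wm_abs e k.+1).-1 = j /\ wm_neg e k.+1 = wm_neg e j.+1.
  by rewrite kE sE addbK.
rewrite /wm_neg /wm_abs /=; case: (boolP (odd j && (j < e))) => [/andP[oj je]|nj].
  have j0 : 0 < j by case: (nat_of_ord j) oj.
  have kV : (wm_abs e j.+1).-1 = e - j.
    by rewrite /wm_abs /= negbK oj je /= addn2 subSS subSn // ltnW.
  have okj : odd (e - j) by rewrite oddB ?(ltnW je) // eo oj.
  have ekj : e - j < e by rewrite ltn_subrL j0 (leq_ltn_trans _ je).
  have [en|ne] := ltnP (e - j) n.
    have kE : k = e - j :> nat by rewrite /k kV ord_nearE.
    have k1 : (k.+1 == 1%N) = false by rewrite kE eqSS; case: (e - j) okj.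
    rewrite k1 kE !negbK okj ekj oj je eqSS gtn_eqF //; split=> //.
    apply: ord_inj; rewrite addn2 subSS subSn ?leq_subr //= subKn ?(ltnW je) //.
    by rewrite ord_nearE.
  have kE : k = j.
    by rewrite /k kV; apply: ord_inj; rewrite /ord_near val_insubd ltnNge ne.
  by rewrite kE; split=> //; exact: kE.
have kE : k = j.
  by rewrite /k /wm_abs /= negbK (negbTE nj); apply: ord_inj; rewrite ord_nearE /= ?ltn_ord.
by rewrite kE; split=> //; exact: kE.
Qed.

Definition wm n (m : nat) : {perm pt n} := perm (@wm_fun_inj n m).
Arguments wm : clear implicits.

(* Main.v *)
Require Import Defs.
From mathcomp Require Import all_boot all_fingroup.
From mathcomp Require Import zify.

(* Let w be bad. In one-line notation the condition on the ends of reduced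
   expressions says that w(i) < w(i+2) for all i and |w(1)| < w(3), and the
   condition on their beginnings says the same of the inverse of w: three
   consecutive positions whose extreme entries are inverted carry a reduced
   expression ending with two noncommuting generators. So only w(1) and an
   initial segment of the even positions can be negative, and likewise for values.
   If |w(1)| = 1, the negative even entries are -m, ..., -4, -2 in increasing
   order of position for some even m; the odd positions below m are fixed,
   since otherwise w would exchange the increasing sequences of odd and even
   positions with a shift that runs out of room, and beyond m the permutation
   swaps disjoint pairs of neighbours. If |w(1)| is not 1, the same argument
   forces |w(1)| = 2 and |w(2)| = 1, and w is a product of commuting
   generators. *)

Set Implicit Arguments.
Unset Strict Implicit.
Unset Printing Implicit Defensive.

Local Open Scope group_scope.
Local Open Scope nat_scope.

(** * Permutations increasing along two parity classes *)

(** Every step loses at least one. Counting from the last index gives a - 1 - k <= F k, counting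
    from the first gives F k <= b - 1 - k, and the two bounds meet when a = b. *)
Lemma decreasing_bound (F : nat -> nat) a b :
  (forall k, k < a -> F k < b) -> (forall k, k.+1 < a -> F k.+1 < F k) ->
  a <= b /\ (a = b -> forall k, k < a -> F k = a.-1 - k).
Proof.
move=> Fb Fd.
have low d : d < a -> d <= F (a.-1 - d).
  elim: d => // d IH da.
  have := Fd (a.-1 - d.+1); have -> : (a.-1 - d.+1).+1 = a.-1 - d by lia.
  have := IH (ltnW da); lia.
have up k : k < a -> F k + k < b.
  elim: k => [|k IH] ka; first by rewrite addn0 Fb.
  have := Fd k ka; have := IH (ltnW ka); lia.
split=> [|ab k ka]; first by case: a Fb Fd low up => // a _ _ _ /(_ a (ltnSn _)); lia.
have := low (a.-1 - k); have := up k ka.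
have -> : a.-1 - (a.-1 - k) = k by lia.
lia.
Qed.

(** A final segment of each parity class. It is used with r + q odd, so that r and q are the least
    members of the two classes. *)
Definition tail r q i := if odd i == odd r then r <= i else q <= i.

Definition half_shuffle n r q (F G : nat -> nat) :=
  [/\ forall i, i < n -> tail r q i -> F i < n /\ tail r q (F i),
      forall i, i < n -> tail r q i -> G (F i) = i
    & forall i, i.+2 < n -> tail r q i -> F i < F i.+2].

Definition shuffle n r q F G :=
  half_shuffle n r q F G /\ half_shuffle n r q G F.

Lemma half_shuffle_mono n r q F G i j : half_shuffle n r q F G ->
  j < n -> tail r q i -> i <= j -> odd i = odd j -> F i <= F j.
Proof.
move=> [_ _ Fm] jn ti ij oij.
have [d jE] : exists d, j = i + d.*2 by exists (j - i)./2; lia.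
rewrite {}jE {j ij oij} in jn *; elim: d jn => [|d IH] jn; first by rewrite addn0.
have dS : i + d.+1.*2 = (i + d.*2).+2 by lia.
rewrite dS in jn *.
have tid : tail r q (i + d.*2).
  by move: ti; rewrite /tail oddD odd_double addbF; case: ifP => _; lia.
have := Fm _ jn tid; have := IH (ltnW (ltnW jn)); lia.
Qed.

(** The number r is the least of the tail. If G r has the parity of r, monotonicity gives F r <= F
    (G r) = r; if F r does, the same holds for G. Otherwise q <= F r and q <= G r, and monotonicity
    gives G q <= r and F q <= r. *)
Lemma shuffle_head n r q F G : shuffle n r q F G -> r < q -> odd (r + q) ->
  r < n -> F r = r \/ [/\ q < n, F r = q & F q = r].
Proof.
move=> [hF hG] rq orq rn; have [Fs FK _] := hF; have [Gs GK _] := hG.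
have tr : tail r q r by rewrite /tail eqxx.
have tq : tail r q q by rewrite /tail; case: ifP => //; lia.
have tmin i : tail r q i -> r <= i by rewrite /tail; case: ifP; lia.
have [Frn tFr] := Fs r rn tr; have [Grn tGr] := Gs r rn tr.
case: (eqVneq (odd (G r)) (odd r)) => oG.
  left; have := half_shuffle_mono hF Grn tr (tmin _ tGr) (esym oG).
  rewrite (GK r rn tr); have := tmin _ tFr; lia.
case: (eqVneq (odd (F r)) (odd r)) => oF.
  left; have := half_shuffle_mono hG Frn tr (tmin _ tFr) (esym oF).
  rewrite (FK r rn tr) => Gr; have GE : G r = r by have := tmin _ tGr; lia.
  by have := GK r rn tr; rewrite GE.
right; have qG : q <= G r by move: tGr; rewrite /tail (negbTE oG).
have qF : q <= F r by move: tFr; rewrite /tail (negbTE oF).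
have qn : q < n := leq_ltn_trans qG Grn.
split=> //.
  have oqF : odd q = odd (F r) by lia.
  have := half_shuffle_mono hG Frn tq qF oqF; rewrite (FK r rn tr) => Gq.
  have Gqr : G q = r by have := tmin _ (Gs q qn tq).2; lia.
  by have := GK q qn tq; rewrite Gqr.
have oqG : odd q = odd (G r) by lia.
have := half_shuffle_mono hF Grn tq qG oqG; rewrite (GK r rn tr) => Fq.
by have := tmin _ (Fs q qn tq).2; lia.
Qed.

Lemma shuffle_restrict n r q r' q' F G : shuffle n r q F G ->
  (forall i, tail r' q' i -> tail r q i) ->
  (forall i, i < n -> tail r' q' i -> tail r' q' (F i)) ->
  (forall i, i < n -> tail r' q' i -> tail r' q' (G i)) ->
  shuffle n r' q' F G.
Proof.
move=> [[Fs FK Fm] [Gs GK Gm]] sub F' G'.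
by split; split=> i ?/[dup]/sub ti t'i; auto; split; auto;
  [have [] := Fs i _ ti | have [] := Gs i _ ti].
Qed.

Lemma shuffle_drop1 n r q F G : shuffle n r q F G -> r < n ->
  F r = r -> shuffle n r.+2 q F G.
Proof.
move=> sh rn Fr; have [[Fs FK _] [Gs GK _]] := sh.
have tr : tail r q r by rewrite /tail eqxx.
have Gr : G r = r by have := FK r rn tr; rewrite Fr.
have tE i : tail r.+2 q i = (i != r) && tail r q i by rewrite /tail; do 2?case: ifP; lia.
apply: (shuffle_restrict sh) => i; rewrite !tE; first by case/andP.
  move=> i_n /andP[ir ti]; rewrite (Fs i i_n ti).2 andbT; apply: contra_neq ir => e.
  by rewrite -(FK i i_n ti) e Gr.
move=> i_n /andP[ir ti]; rewrite (Gs i i_n ti).2 andbT; apply: contra_neq ir => e.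
by rewrite -(GK i i_n ti) e Fr.
Qed.

Lemma shuffle_drop2 n r q F G : shuffle n r q F G -> odd (r + q) ->
  r < n -> q < n -> F r = q -> F q = r -> shuffle n r.+2 q.+2 F G.
Proof.
move=> sh orq rn qn Fr Fq; have [[Fs FK _] [Gs GK _]] := sh.
have tr : tail r q r by rewrite /tail eqxx.
have tq : tail r q q by rewrite /tail; case: ifP => //; lia.
have Gr : G r = q by have := FK q qn tq; rewrite Fq.
have Gq : G q = r by have := FK r rn tr; rewrite Fr.
have tE i : tail r.+2 q.+2 i = [&& i != r, i != q & tail r q i].
  by rewrite /tail; do 2?case: ifP; lia.
apply: (shuffle_restrict sh) => i; rewrite !tE; first by case/and3P.
  move=> i_n /and3P[ir iq ti]; rewrite (Fs i i_n ti).2 andbT;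
  by apply/andP; split; apply/eqP => e; move: (FK i i_n ti) ir iq; rewrite e ?Gr ?Gq => ->; rewrite eqxx.
move=> i_n /and3P[ir iq ti]; rewrite (Gs i i_n ti).2 andbT;
by apply/andP; split; apply/eqP => e; move: (GK i i_n ti) ir iq; rewrite e ?Fr ?Fq => ->; rewrite eqxx.
Qed.

(* Otherwise F exchanges r + 2k with q + 2k for all k, until q + 2k leaves
   the range while r + 2k is still inside. *)
Lemma shuffle_head_fixed n r q F G : shuffle n r q F G -> r.+2 < q ->
  odd (r + q) -> r < n -> F r = r.
Proof.
elim/ltn_ind: {r}(n - r) {-2}r q (erefl (n - r)) => d IH r q dE sh rq orq rn.
have [//|[qn Fr Fq]] := shuffle_head sh (ltnW (ltnW rq)) orq rn.
have sh2 := shuffle_drop2 sh orq rn qn Fr Fq.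
have rn2 : r.+2 < n := ltn_trans rq qn.
have [[_ _ Fm] _] := sh.
have tr : tail r q r by rewrite /tail eqxx.
(* With this, F r = q < F r.+2 = r.+2 contradicts r.+2 < q. *)
have Fr2 : F r.+2 = r.+2 by apply: (IH (n - r.+2) _ r.+2 q.+2) => //; lia.
have := Fm r rn2 tr; lia.
Qed.

(** By [shuffle_head_fixed] the heads r, r + 2, ... are fixed and can be removed one after another,
    until the two classes start at the neighbours q - 1 and q. *)
Lemma shuffle_fixed n r q F G : shuffle n r q F G -> r < q -> odd (r + q) ->
  q <= n.+1 ->
  (forall i, odd i = odd r -> r <= i -> i.+1 < q -> F i = i) /\
  shuffle n q.-1 q F G.
Proof.
elim/ltn_ind: {r}(q - r) {-2}r (erefl (q - r)) => d IH r dE sh rq orq qn.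
have [qr|rq2] := eqVneq q r.+1.
  by rewrite qr /=; split=> [i|]; [lia | rewrite -qr].
have r2q : r.+2 < q by lia.
have rn : r < n by lia.
have Fr := shuffle_head_fixed sh r2q orq rn.
have /(IH (q - r.+2)) := shuffle_drop1 sh rn Fr.
case=> //; [by rewrite -dE; lia | by lia | move=> H ?].
split=> // i oi ri iq; have [->//|ir] := eqVneq i r; apply: H; lia.
Qed.

(** By [shuffle_head] either r is fixed or r and r + 1 are swapped. In both cases the remaining tail
    again has neighbouring heads, so F is a product of disjoint adjacent swaps. *)
Lemma shuffle_swap n r F G : shuffle n r r.+1 F G ->
  forall i, r <= i -> i < n -> [/\ r <= F i, F i <= i.+1, i <= (F i).+1 & F (F i) = i].
Proof.
elim/ltn_ind: {r}(n - r) {-2}r (erefl (n - r)) => d IH r dE sh i ri i_n.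
have rn := leq_ltn_trans ri i_n.
have orr : odd (r + r.+1) by lia.
have [Fr|[qn Fr Fq]] := shuffle_head sh (ltnSn r) orr rn.
  have [->|ir] := eqVneq i r; first by rewrite !Fr.
  have sh1 := shuffle_drop1 sh rn Fr.
  (* Once r is removed, the other parity class has the smaller head. *)
  have tE j : tail r.+1 r.+2 j = tail r.+2 r.+1 j by rewrite /tail; do 2?case: ifP; lia.
  have sh2 : shuffle n r.+1 r.+2 F G.
    have [[Fs _ _] [Gs _ _]] := sh1.
    by apply: (shuffle_restrict sh1) => j; rewrite !tE // => jn tj; [case: (Fs j jn tj)|case: (Gs j jn tj)].
  have /(IH (n - r.+1))/(_ i)[] := sh2 => //; try lia; split=> //; lia.
have [->|ir] := eqVneq i r; first by rewrite Fr Fq; split; lia.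
have [->|ir1] := eqVneq i r.+1; first by rewrite Fq Fr; split; lia.
have sh2 := shuffle_drop2 sh orr rn qn Fr Fq.
have /(IH (n - r.+2))/(_ i)[] := sh2 => //; try lia; split=> //; lia.
Qed.

(** * The shape of the one-line notation *)

(* F k and E k stand for |w k| and the sign of w k, G and E' for those of the
   inverse of w; positions and values are numbered from 0. *)
Definition rank_of n (F : nat -> nat) (E : nat -> bool) k :=
  if E k then n - (F k).+1 else n + F k.

(** Subtracting a rank from 2n - 1 negates the entry, so [ss_step0] says -w(1) < w(3). With
    [ss_step] at 0 this is |w(1)| < w(3). *)
Record signed_seq n (F G : nat -> nat) (E E' : nat -> bool) : Prop := SignedSeq {
  ss_lt : forall k, k < n -> F k < n;
  ss_K : forall k, k < n -> G (F k) = k;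
  ss_sgn : forall k, k < n -> E' (F k) = E k;
  ss_step : forall k, k.+2 < n -> rank_of n F E k < rank_of n F E k.+2;
  ss_step0 : (n + n).-1 - rank_of n F E 0 < rank_of n F E 2 }.

(** Positions count from 0, so the odd ones are the even ones of one-line notation. Position 0 and
    the first a odd positions are left out. *)
Definition outer a i := (0 < i) && (odd i ==> (a.*2 < i)).

(** This is the chain |w(1)| < w(3) < w(5) < ... of one-line notation. *)
Lemma even_pos n F G E E' : 2 < n -> signed_seq n F G E E' ->
  forall k, ~~ odd k -> 0 < k -> k < n -> ~~ E k && (F 0 < F k).
Proof.
move=> n2 [Flt _ _ step step0] k ok k0 kn.
have [d kE] : exists d, k = d.+1.*2 by exists (k./2.-1); lia.
rewrite {}kE {k ok k0} in kn *; elim: d kn => [|d IH] kn.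
  rewrite -[1.*2]/2; have := step 0 n2; have := step0; rewrite /rank_of.
  have := Flt 0 (ltnW (ltnW n2)); have := Flt 2 n2.
  by case: (E 0); case: (E 2) => /=; lia.
have dn : d.+1.*2 < n by lia.
have := step d.+1.*2; have := IH dn; have := Flt _ dn; have := Flt _ kn.
rewrite (_ : d.+2.*2 = d.+1.*2.+2) // /rank_of.
by case: (E _); case: (E _) => //=; lia.
Qed.

Lemma neg_odd n F G E E' k : 2 < n -> signed_seq n F G E E' ->
  0 < k -> k < n -> E k -> odd k.
Proof.
move=> n2 S k0 kn; apply: contraLR => ok.
by have /andP[] := even_pos n2 S ok k0 kn.
Qed.

Lemma neg_step n F G E E' k : signed_seq n F G E E' -> k.+2 < n ->
  E k.+2 -> E k /\ F k.+2 < F k.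
Proof.
move=> [Flt _ _ step _] kn; have := step k kn; have := Flt _ kn.
have := Flt k (ltnW (ltnW kn)).
rewrite /rank_of => ? ? + E2; rewrite E2; case: (E k); lia.
Qed.

Lemma pos_step n F G E E' k : signed_seq n F G E E' -> k.+2 < n ->
  ~~ E k -> ~~ E k.+2 /\ F k < F k.+2.
Proof.
move=> [Flt _ _ step _] kn; have := step k kn; have := Flt _ kn.
rewrite /rank_of => ? + /negbTE E2; rewrite E2; case: (E k.+2); lia.
Qed.

Lemma neg_prefix n F G E E' : signed_seq n F G E E' ->
  exists p, (forall k, k < p -> k.*2.+1 < n /\ E k.*2.+1) /\
    (forall k, p <= k -> k.*2.+1 < n -> ~~ E k.*2.+1).
Proof.
move=> S; pose P p := (n <= p.*2.+1) || ~~ E p.*2.+1.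
have exP : exists p, P p by exists n; rewrite /P; lia.
case: (ex_minnP exP) => p Pp pmin; exists p; split=> [k kp|].
  have : ~~ P k by apply: contraL kp => /pmin; lia.
  by rewrite /P negb_or negbK -ltnNge => /andP.
elim=> [|k IH] pk kn; first by case/orP: Pp => //; have -> : p = 0; lia.
have [pk1|kp] := leqP p k; last by have <- : p = k.+1; [lia|case/orP: Pp => //; lia].
have kn' : k.*2.+1 < n by lia.
by have [] := pos_step S kn (IH pk1 kn').
Qed.

(** [decreasing_bound] gives a <= b from F and b <= a from G. A strictly decreasing map of an
    initial segment into itself is its reversal. *)
Lemma odd_block (F G : nat -> nat) a b :
  (forall k, k < a -> odd (F k.*2.+1) /\ F k.*2.+1 < b.*2) ->
  (forall k, k.+1 < a -> F k.+1.*2.+1 < F k.*2.+1) ->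
  (forall k, k < b -> odd (G k.*2.+1) /\ G k.*2.+1 < a.*2) ->
  (forall k, k.+1 < b -> G k.+1.*2.+1 < G k.*2.+1) ->
  [/\ a = b, forall k, k < a -> F k.*2.+1 = (a.-1 - k).*2.+1
    & forall k, k < a -> G k.*2.+1 = (a.-1 - k).*2.+1].
Proof.
have key (f : nat -> nat) c d : (forall k, k < c -> odd (f k.*2.+1) /\ f k.*2.+1 < d.*2) ->
    (forall k, k.+1 < c -> f k.+1.*2.+1 < f k.*2.+1) ->
    c <= d /\ (c = d -> forall k, k < c -> f k.*2.+1 = (c.-1 - k).*2.+1).
  move=> fo fd; have [||cd fE] := @decreasing_bound (fun k => (f k.*2.+1)./2) c d.
  - by move=> k /fo; lia.
  - by move=> k kc; have := fd k kc; have := fo _ kc; have := fo k (ltnW kc); lia.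
  by split=> // e k kc; have := fE e k kc; have := fo k kc; lia.
move=> F1 F2 G1 G2; have [ab FE] := key F a b F1 F2; have [ba GE] := key G b a G1 G2.
have e : a = b by lia.
by split=> // k ka; [apply: FE | rewrite e; apply: GE => //; rewrite -e].
Qed.

Lemma outer_half_shuffle n F G E E' a r q : 2 < n -> signed_seq n F G E E' ->
  (forall i, tail r q i = outer a i) ->
  (forall i, i < n -> outer a i -> ~~ E i) ->
  (forall i, i < n -> outer a i -> outer a (F i)) ->
  half_shuffle n r q F G.
Proof.
move=> n2 S tE pos st; split=> i i_n; rewrite !tE => oi.
- by split; [apply: ss_lt S _ i_n | apply: st].
- exact: ss_K S _ i_n.
- by have [] := pos_step S i_n (pos i (ltnW (ltnW i_n)) oi).
Qed.

(** If F i were left out, the hypotheses would force i = G (F i) to be left out as well. *)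
Lemma outer_stable n F G E E' a : signed_seq n F G E E' ->
  (forall k, k < n -> F k = 0 -> ~~ outer a k) ->
  (forall k, k < a -> k.*2.+1 < n -> ~~ outer a (G k.*2.+1)) ->
  forall i, i < n -> outer a i -> outer a (F i).
Proof.
move=> S F0 Gb i i_n oi; rewrite {1}/outer lt0n; apply/andP; split.
  by apply: contraL oi => /eqP /(F0 i i_n).
apply/implyP => oF; rewrite ltnNge; apply: contraL oi => Fa.
have [k kE] : exists k, F i = k.*2.+1 by exists (F i)./2; lia.
have := Gb k; rewrite -kE (ss_K S i_n) (ss_lt S i_n); apply=> //; lia.
Qed.

(** Let p and p' count the negative entries of w and of its inverse. These entries fill initial
    segments of the odd positions, between which w and its inverse are decreasing, so [odd_block]
    gives p = p' and the reversal. What is left is a shuffle. *)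
Lemma shape_fixed_first n F G E E' : 2 < n ->
  signed_seq n F G E E' -> signed_seq n G F E' E -> F 0 = 0 ->
  exists p,
  [/\ p.*2 <= n,
      forall k, k < p -> E k.*2.+1 /\ F k.*2.+1 = (p.-1 - k).*2.+1,
      forall k, k < n -> outer p k -> ~~ E k,
      forall k, ~~ odd k -> k < p.*2 -> F k = k
    & shuffle n (maxn 1 p.*2) (maxn 1 p.*2).+1 F G].
Proof.
move=> n2 S S' F0; have n0 : 0 < n by lia.
have G0 : G 0 = 0 by have := ss_K S n0; rewrite F0.
have [p [pneg ppos]] := neg_prefix S; have [p' [pneg' ppos']] := neg_prefix S'.
(* The local facts are stated for arbitrary data because each serves both w and its inverse. *)
have side f g e e' c d : signed_seq n f g e e' -> signed_seq n g f e' e -> g 0 = 0 ->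
    (forall k, k < c -> k.*2.+1 < n /\ e k.*2.+1) ->
    (forall k, d <= k -> k.*2.+1 < n -> ~~ e' k.*2.+1) ->
    forall k, k < c -> odd (f k.*2.+1) /\ f k.*2.+1 < d.*2.
  move=> s s' g0 cneg dpos k kc; have [kn ek] := cneg k kc.
  have en : e' (f k.*2.+1) by rewrite (ss_sgn s kn).
  have fn := ss_lt s kn.
  have f0 : 0 < f k.*2.+1.
    by rewrite lt0n; apply/eqP => f0; have := ss_K s kn; rewrite f0 g0.
  have fo := neg_odd n2 s' f0 fn en; split=> //.
  rewrite ltnNge; apply/negP => fd.
  have [l lE] : exists l, f k.*2.+1 = l.*2.+1 by exists (f k.*2.+1)./2; lia.
  by have := dpos l; rewrite -lE en fn => H; suff : false by []; apply: H => //; lia.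
have dec f g e e' c : signed_seq n f g e e' ->
    (forall k, k < c -> k.*2.+1 < n /\ e k.*2.+1) ->
    forall k, k.+1 < c -> f k.+1.*2.+1 < f k.*2.+1.
  move=> s cneg k kc; have [kn ek] := cneg _ kc.
  by have [] := neg_step s kn ek.
have [e FE GE] := odd_block (side _ _ _ _ _ _ S S' G0 pneg ppos') (dec _ _ _ _ _ S pneg)
  (side _ _ _ _ _ _ S' S F0 pneg' ppos) (dec _ _ _ _ _ S' pneg').
subst p'.
have out_pos f g e e' : signed_seq n f g e e' ->
    (forall k, p <= k -> k.*2.+1 < n -> ~~ e k.*2.+1) ->
    forall i, i < n -> outer p i -> ~~ e i.
  move=> s pos i i_n /andP[i0 oi]; have [io|ie] := boolP (odd i).
    have [l lE] : exists l, i = l.*2.+1 by exists i./2; lia.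
    by rewrite lE; apply: pos; lia.
  by have /andP[] := even_pos n2 s ie i0 i_n.
have out_st f g e e' : signed_seq n f g e e' -> g 0 = 0 ->
    (forall k, k < p -> g k.*2.+1 = (p.-1 - k).*2.+1) ->
    forall i, i < n -> outer p i -> outer p (f i).
  move=> s g0 gE; apply: (outer_stable s) => k.
    by move=> kn fk; have := ss_K s kn; rewrite fk g0 => <-.
  by move=> kp _; rewrite gE // /outer /= odd_double; lia.
have sh r q : (forall i, tail r q i = outer p i) -> shuffle n r q F G.
  move=> tE; split.
    exact: (outer_half_shuffle n2 S tE (out_pos _ _ _ _ S ppos) (out_st _ _ _ _ S G0 GE)).
  exact: (outer_half_shuffle n2 S' tE (out_pos _ _ _ _ S' ppos') (out_st _ _ _ _ S' F0 FE)).
have pn : p.*2 <= n.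
  have [->|p0] := posnP p; first by [].
  have [|] := pneg p.-1; lia.
exists p; split=> //.
- by move=> k kp; rewrite FE //; have [] := pneg k kp.
- exact: (out_pos _ _ _ _ S ppos).
- move=> k ke kp; have [->//|k0] := posnP k.
  have s2 : shuffle n 2 p.*2.+1 F G.
    by apply: sh => i; rewrite /tail /outer; case: ifP; lia.
  by case: (shuffle_fixed s2) => [|||H _]; [lia | lia | lia | apply: H; lia].
(* Without negative odd positions only position 0 is left out, and the heads are 1 and 2; this is
   the reason for [maxn 1]. *)
have [p0|p0] := posnP p; first by apply: sh => i; rewrite /tail /outer; case: ifP; lia.
have s2 : shuffle n 2 p.*2.+1 F G.
  by apply: sh => i; rewrite /tail /outer; case: ifP; lia.
rewrite (_ : maxn 1 p.*2 = p.*2); last by lia.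
by case: (shuffle_fixed s2) => [|||_ //]; lia.
Qed.

(** Write G 0 = 2a + 1 and F 0 = 2b + 1. The odd positions before 2a + 1 are the negative ones, so
    [odd_block] gives a = b, and beyond them w is a shuffle with heads 2 and 2a + 3. If a > 0,
    position 2 is fixed, against F 0 < F 2. *)
Lemma shape_moved_first n F G E E' : 2 < n ->
  signed_seq n F G E E' -> signed_seq n G F E' E -> 0 < F 0 ->
  [/\ F 0 = 1, F 1 = 0, forall k, 1 < k -> k < n -> ~~ E k & shuffle n 2 3 F G].
Proof.
move=> n2 S S' F0; have n0 : 0 < n by lia.
have Fn := ss_lt S n0; have Gn := ss_lt S' n0.
have GF := ss_K S n0; have FG := ss_K S' n0.
have G0 : 0 < G 0 by rewrite lt0n; apply: contraTneq F0 => G0; rewrite -G0 FG.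
have oF : odd (F 0).
  apply: contraT => e; have /andP[_] := even_pos n2 S' e F0 Fn.
  by rewrite GF.
have oG : odd (G 0).
  apply: contraT => e; have /andP[_] := even_pos n2 S e G0 Gn.
  by rewrite FG.
have [a aE] : exists a, G 0 = a.*2.+1 by exists (G 0)./2; lia.
have [b bE] : exists b, F 0 = b.*2.+1 by exists (F 0)./2; lia.
(* The least absolute value sits at 2c + 1. A nonnegative entry before it would make absolute values
   increase up to it, and a negative entry after it would need a smaller absolute value. *)
have sgn f g e e' c : signed_seq n f g e e' -> g 0 = c.*2.+1 -> c.*2.+1 < n -> f c.*2.+1 = 0 ->
    (forall k, k < c -> e k.*2.+1) /\ (forall k, c < k -> k.*2.+1 < n -> ~~ e k.*2.+1).
  move=> s gc cn fc; split=> k.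
    move=> kc; apply: contraT => ek; suff : 0 < f c.*2.+1 by rewrite fc.
    have el l : k <= l -> l.*2.+1 < n -> ~~ e l.*2.+1.
      elim: l => [|l IH] kl ln; first by have <- : k = 0 by lia.
      have [kl'|lk] := leqP k l; last by have <- : k = l.+1 by lia.
      by have [] := pos_step s ln (IH kl' (ltnW (ltnW ln))).
    case: c kc cn {gc fc} => // c kc cn.
    by have [_] := pos_step s cn (el c kc (ltnW (ltnW cn))); apply: leq_trans.
  elim: k => // k IH ck kn; apply/negP => ek; have [ek' lt] := neg_step s kn ek.
  have [ck'|kc] := ltnP c k; first by have := IH ck' (ltnW (ltnW kn)); rewrite ek'.
  have e0 : k = c by lia.
  by move: lt; rewrite e0 fc ltn0.
have an : a.*2.+1 < n by rewrite -aE.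
have bn : b.*2.+1 < n by rewrite -bE.
have Fa : F a.*2.+1 = 0 by rewrite -aE.
have Gb : G b.*2.+1 = 0 by rewrite -bE.
have [neg pos] := sgn _ _ _ _ _ S aE an Fa; have [neg' pos'] := sgn _ _ _ _ _ S' bE bn Gb.
have side f g e e' c d : signed_seq n f g e e' -> signed_seq n g f e' e ->
    g 0 = c.*2.+1 -> c.*2.+1 < n -> f 0 = d.*2.+1 ->
    (forall k, k < c -> e k.*2.+1) ->
    (forall k, d < k -> k.*2.+1 < n -> ~~ e' k.*2.+1) ->
    forall k, k < c -> odd (f k.*2.+1) /\ f k.*2.+1 < d.*2.
  move=> s s' g0 cn f0 cneg dpos k kc; have ek := cneg k kc.
  have kn : k.*2.+1 < n by lia.
  have en : e' (f k.*2.+1) by rewrite (ss_sgn s kn).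
  have fn := ss_lt s kn.
  have fp : 0 < f k.*2.+1.
    by rewrite lt0n; apply/eqP => fz; have := ss_K s kn; rewrite fz g0; lia.
  have fo := neg_odd n2 s' fp fn en; split=> //.
  have fd : f k.*2.+1 != d.*2.+1.
    by apply/eqP => fz; have := ss_K s kn; rewrite fz -f0 (ss_K s n0).
  rewrite ltnNge; apply/negP => fd'.
  have [l lE] : exists l, f k.*2.+1 = l.*2.+1 by exists (f k.*2.+1)./2; lia.
  by have := dpos l; rewrite -lE en fn => H; suff : false by []; apply: H => //; lia.
have dec f g e e' c : signed_seq n f g e e' -> c.*2.+1 < n -> (forall k, k < c -> e k.*2.+1) ->
    forall k, k.+1 < c -> f k.+1.*2.+1 < f k.*2.+1.
  move=> s cn cneg k kc; have kn : k.*2.+3 < n by lia.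
  by have [] := neg_step s kn (cneg _ kc).
have [e FE GE] := odd_block (side _ _ _ _ _ _ S S' aE an bE neg pos') (dec _ _ _ _ _ S an neg)
  (side _ _ _ _ _ _ S' S bE bn aE neg' pos) (dec _ _ _ _ _ S' bn neg').
subst b.
have out_pos f g e0 e' : signed_seq n f g e0 e' ->
    (forall k, a < k -> k.*2.+1 < n -> ~~ e0 k.*2.+1) ->
    forall i, i < n -> outer a.+1 i -> ~~ e0 i.
  move=> s ps i i_n /andP[i0 oi]; have [io|ie] := boolP (odd i).
    have [l lE] : exists l, i = l.*2.+1 by exists i./2; lia.
    by rewrite lE; apply: ps; lia.
  by have /andP[] := even_pos n2 s ie i0 i_n.
have out_st f g e0 e' : signed_seq n f g e0 e' -> g 0 = a.*2.+1 -> g a.*2.+1 = 0 ->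
    (forall k, k < a -> g k.*2.+1 = (a.-1 - k).*2.+1) ->
    forall i, i < n -> outer a.+1 i -> outer a.+1 (f i).
  move=> s g0 ga gE; apply: (outer_stable s) => k.
    by move=> kn fk; have := ss_K s kn; rewrite fk g0 => <-; rewrite /outer; lia.
  move=> kp _; have [->|ka] := eqVneq k a; first by rewrite ga.
  by rewrite gE /outer; lia.
have sh r q : (forall i, tail r q i = outer a.+1 i) -> shuffle n r q F G.
  move=> tE; split.
    exact: (outer_half_shuffle n2 S tE (out_pos _ _ _ _ S pos) (out_st _ _ _ _ S aE Gb GE)).
  exact: (outer_half_shuffle n2 S' tE (out_pos _ _ _ _ S' pos') (out_st _ _ _ _ S' bE Fa FE)).
have s2 : shuffle n 2 a.*2.+3 F G.
  by apply: sh => i; rewrite /tail /outer; case: ifP; lia.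
have a0 : a = 0.
  apply/eqP; rewrite -leqn0 leqNgt; apply/negP => a0.
  have F2 : F 2 = 2 by apply: (shuffle_head_fixed s2); lia.
  by have /andP[_] := even_pos n2 S (isT : ~~ odd 2) isT n2; rewrite F2 bE; lia.
subst a; split=> // k k1 kn; apply: (out_pos _ _ _ _ S pos) => //.
by rewrite /outer; lia.
Qed.

(** * Inversions and the length function *)

(* The rank of the integer encoded by a in -n < ... < -1 < 1 < ... < n. *)
Definition srank n (a : pt n) : nat := if a.1 then n - a.2.+1 else n + a.2.

Definition neg_compat n (w : {perm pt n}) := forall a, w (ptneg a) = ptneg (w a).

(** The pair [root_lo i], [root_hi i] encodes a simple root: [sgen i] exchanges the two points. For
    [i = 0] they are -2 and 1. *)
Definition root_lo n (i : 'I_n) : pt n :=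
  if i == 0 :> nat then (true, ord_near i 1) else (false, ord_near i i.-1).

Definition root_hi n (i : 'I_n) : pt n := (false, i).

Definition descent n (w : {perm pt n}) i : bool :=
  srank (w (root_hi i)) < srank (w (root_lo i)).

(* Every positive root of D_n is met twice, as the pairs a < b and -b < -a. *)
Definition inversions n (w : {perm pt n}) : {set pt n * pt n} :=
  [set ab | [&& srank ab.1 < srank ab.2, ab.1.2 != ab.2.2
              & srank (w ab.2) < srank (w ab.1)]].

Lemma srank_ptneg n (a : pt n) : srank (ptneg a) = (n + n).-1 - srank a.
Proof. by case: a => [[] i]; rewrite /srank /=; have := ltn_ord i; lia. Qed.

Lemma srank_lt n (a : pt n) : srank a < n + n.
Proof. by case: a => [[] i]; rewrite /srank /=; have := ltn_ord i; lia. Qed.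

Lemma srank_inj n : injective (@srank n).
Proof.
case=> [[] i] [[] j]; rewrite /srank /= => e;
  have := ltn_ord i; have := ltn_ord j => *; try (congr pair; apply: ord_inj); lia.
Qed.

Lemma srank_ptneg_lt n (a b : pt n) :
  (srank (ptneg a) < srank (ptneg b)) = (srank b < srank a).
Proof. by rewrite !srank_ptneg; have := srank_lt a; have := srank_lt b; lia. Qed.

Lemma neg_compatM n (v w : {perm pt n}) :
  neg_compat v -> neg_compat w -> neg_compat (mulc v w).
Proof. by move=> hv hw a; rewrite /mulc !permM hw hv. Qed.

Lemma neg_compatV n (w : {perm pt n}) : neg_compat w -> neg_compat w^-1.
Proof. by move=> hw a; apply: (@perm_inj _ w); rewrite hw !permKV. Qed.

Lemma neg_compat_abs n (w : {perm pt n}) a b : neg_compat w ->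
  ((w a).2 == (w b).2) = (a.2 == b.2).
Proof.
move=> hw; have key (v : {perm pt n}) c d : neg_compat v -> c.2 = d.2 -> (v c).2 = (v d).2.
  move=> hv cd; have [->//|->] : c = d \/ c = ptneg d.
    by case: c d cd => [[] c] [[] d] /= ->; rewrite /ptneg; auto.
  by rewrite hv.
apply/eqP/eqP; last exact: key.
by move/(key _ _ _ (neg_compatV hw)); rewrite !permK.
Qed.

(** * Action of the simple reflections on inversions *)

Section SimpleReflections.

Variables (n : nat) (n2 : 1 < n).
Implicit Types (i j : 'I_n) (a b : pt n) (w : {perm pt n}).

Lemma sgenE i a : sgen i a =
  if i == 0 :> nat then
    if a.2 == 0 :> nat then (~~ a.1, ord_near i 1)
    else if a.2 == 1 :> nat then (~~ a.1, i) else a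
  else (a.1, if a.2 == i then ord_near i i.-1
             else if a.2 == i.-1 :> nat then i else a.2).
Proof.
case: (eqVneq (i : nat) 0) => [i0|i0].
  have e1 : ord_near i 1 = 1 :> nat by rewrite ord_nearE.
  by rewrite (sgen0 _ i0 e1) -!val_eqE /= i0 e1.
have e1 : ord_near i i.-1 = i.-1 :> nat by rewrite ord_nearE //; have := ltn_ord i; lia.
have e2 : i = (ord_near i i.-1).+1 :> nat by rewrite e1; lia.
by rewrite (sgenS _ e2) -!val_eqE /= e1.
Qed.

Lemma val_ord_near1 i : ord_near i 1 = 1 :> nat.
Proof. exact: ord_nearE. Qed.

Lemma val_ord_near_pred i : ord_near i i.-1 = i.-1 :> nat.
Proof. by rewrite ord_nearE //; have := ltn_ord i; lia. Qed.

Lemma sgen_lo i : sgen i (root_lo i) = root_hi i.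
Proof.
rewrite sgenE /root_lo /root_hi; case: ifP => i0; rewrite ?i0 /= ?val_ord_near1 //.
by rewrite -val_eqE /= val_ord_near_pred ifN ?eqxx //; lia.
Qed.

Lemma sgen_hi i : sgen i (root_hi i) = root_lo i.
Proof. by rewrite sgenE /root_lo /root_hi; case: ifP => /= [->|_]; rewrite ?eqxx. Qed.

Lemma sgen_neg i : neg_compat (sgen i).
Proof.
by case=> b j; rewrite !sgenE /ptneg /=; do 3?case: ifP => //=; rewrite ?negbK.
Qed.

Lemma sgenK i : involutive (sgen i).
Proof.
case=> b j; rewrite !sgenE /=; have := val_ord_near1 i; have := val_ord_near_pred i.
move=> ep e1; rewrite -!val_eqE.
do ![case: ifP => /=]; rewrite ?negbK ?ep ?e1 => *;
  first [by [] | by congr pair; apply: ord_inj; rewrite ?ep ?e1; lia | exfalso; lia].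
Qed.

Lemma root_lo_hi i : srank (root_lo i) < srank (root_hi i).
Proof.
rewrite /root_lo /root_hi; case: ifP => i0; rewrite /srank /=.
  by rewrite val_ord_near1; lia.
by rewrite val_ord_near_pred; lia.
Qed.

Lemma root_abs i : (root_lo i).2 != (root_hi i).2.
Proof.
rewrite -val_eqE /root_lo /root_hi; case: ifP => /= i0.
  by rewrite val_ord_near1; lia.
by rewrite val_ord_near_pred; lia.
Qed.

(** A simple reflection makes only its own root negative. For [i = 0] it also reverses the pairs
    (-1, 1) and (-2, 2), which are not roots of type D; hence the condition on absolute values. *)
Lemma sgen_mono i a b : srank a < srank b -> a.2 != b.2 ->
  (a, b) != (root_lo i, root_hi i) ->
  (a, b) != (ptneg (root_hi i), ptneg (root_lo i)) ->
  srank (sgen i a) < srank (sgen i b).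
Proof.
have := val_ord_near1 i; have := val_ord_near_pred i => ep e1.
case: a b => [c x] [d y] /=; have := ltn_ord x; have := ltn_ord y; have := ltn_ord i.
rewrite !sgenE /root_lo /root_hi; case: ifP => i0; rewrite !xpair_eqE -!val_eqE /= ?ep ?e1 => Hi Hy Hx;
  case: c; case: d; rewrite /srank /=; do ![case: ifP => /=]; rewrite ?ep ?e1; lia.
Qed.

Lemma mulc_sgenK w i : mulc (mulc w (sgen i)) (sgen i) = w.
Proof. by apply/permP => a; rewrite /mulc !permM sgenK. Qed.

Lemma descent_sgen w i : descent (mulc w (sgen i)) i = ~~ descent w i.
Proof.
rewrite /descent /mulc !permM sgen_hi sgen_lo -leqNgt ltn_neqAle.
case: (eqVneq (srank (w _))) => //= /srank_inj/perm_inj e.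
by have := root_lo_hi i; rewrite e ltnn.
Qed.

(** Applying [sgen i] to both points maps the inversions of the shorter element bijectively onto
    those of w, except for the two pairs that encode the root of [sgen i]. *)
Lemma card_inversions_descent w i : neg_compat w -> descent w i ->
  #|inversions w| = #|inversions (mulc w (sgen i))| + 2.
Proof.
move=> hw dw; set x := root_lo i; set y := root_hi i.
pose s (ab : pt n * pt n) := (sgen i ab.1, sgen i ab.2).
have sK : involutive s by case=> a b; rewrite /s /= !sgenK.
have lxy : srank x < srank y := root_lo_hi i.
have xy : x.2 != y.2 := root_abs i.
have wyx : srank (w y) < srank (w x) := dw.
have inx : (x, y) \in inversions w by rewrite inE /= lxy xy.
have iny : (ptneg y, ptneg x) \in inversions w :\ (x, y).
  rewrite !inE /= !hw !srank_ptneg_lt lxy wyx (eq_sym y.2) xy !andbT.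
  by apply/eqP => -[] /(congr1 (fun a => a.2))/eqP; rewrite /= eq_sym (negbTE xy).
rewrite (cardsD1 (x, y)) inx (cardsD1 (ptneg y, ptneg x)) iny.
rewrite addnA addnC; congr (_ + _).
rewrite -(card_imset (inversions (mulc _ _)) (inv_inj sK)); apply: eq_card => -[a b].
rewrite -[in RHS](sK (a, b)) (mem_imset _ _ (inv_inj sK)) !inE /= /mulc !permM !sgenK.
rewrite (neg_compat_abs _ _ (sgen_neg i)).
apply/and4P/and3P => [[ne1 ne2 ltab /andP[ab wab]]|[ltab ab wab]].
  by split=> //; apply: sgen_mono; rewrite // eq_sym.
have ne1 : (sgen i a, sgen i b) != (x, y).
  apply/eqP => -[/(canRL (sgenK i)) ea /(canRL (sgenK i)) eb].
  by move: wab; rewrite ea eb sgen_lo sgen_hi ltnNge ltnW.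
have ne2 : (sgen i a, sgen i b) != (ptneg y, ptneg x).
  apply/eqP => -[/(canRL (sgenK i)) ea /(canRL (sgenK i)) eb].
  by move: wab; rewrite ea eb !(sgen_neg i) sgen_lo sgen_hi !hw srank_ptneg_lt ltnNge ltnW.
have := sgen_mono ltab _ ne1 ne2; rewrite !sgenK (neg_compat_abs _ _ (sgen_neg i)) ab => /(_ isT) lab.
split=> //.
  by apply/eqP => -[ea eb]; move: ltab; rewrite ea eb (sgen_neg i) (sgen_neg i) sgen_lo sgen_hi srank_ptneg_lt ltnNge ltnW.
by apply/eqP => -[ea eb]; move: ltab; rewrite ea eb sgen_lo sgen_hi ltnNge ltnW.
Qed.

Lemma card_inversions_ascent w i : neg_compat w -> ~~ descent w i ->
  #|inversions (mulc w (sgen i))| = #|inversions w| + 2.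
Proof.
move=> hw dw; rewrite (@card_inversions_descent (mulc w (sgen i)) i).
- by rewrite mulc_sgenK.
- exact: neg_compatM (sgen_neg i).
- by rewrite descent_sgen.
Qed.

End SimpleReflections.

Lemma word_cat n (s t : seq 'I_n) : word (s ++ t) = mulc (word s) (word t).
Proof.
by elim: s => [|i s IH] /=; rewrite /mulc ?mulg1 // IH /mulc mulgA.
Qed.

Lemma word_rcons n (s : seq 'I_n) i : word (rcons s i) = mulc (word s) (sgen i).
Proof. by rewrite -cats1 word_cat /= /mulc mul1g. Qed.

Lemma sgen_WD n (i : 'I_n) : sgen i \in WD n.
Proof. by rewrite WD_gen mem_gen // imset_f. Qed.

Lemma mulc_WD n (v w : {perm pt n}) : v \in WD n -> w \in WD n -> mulc v w \in WD n.
Proof. by move=> *; apply: groupM. Qed.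

Lemma word_WD n (s : seq 'I_n) : word s \in WD n.
Proof.
by elim: s => [|i s IH]; [apply: group1 | apply: mulc_WD => //; apply: sgen_WD].
Qed.

Lemma WD_neg n (w : {perm pt n}) : w \in WD n -> neg_compat w.
Proof. by case/WDP. Qed.

(** * Length, reduced expressions and bad elements *)

Section Length.

Variables (n : nat) (n2 : 1 < n).
Implicit Types (i j : 'I_n) (a b : pt n) (w : {perm pt n}) (s : seq 'I_n).

(** The ascents give w(1) < ... < w(n) and -w(2) < w(1), so only w(1) can be negative, and parity
    excludes that. An increasing sequence of n positive entries is the identity. *)
Lemma no_descent w : w \in WD n -> (forall i, ~~ descent w i) -> w = 1%g.
Proof.
case/WDP => hw par asc.
pose o := Ordinal (ltnW n2); pose r k := srank (w (false, ord_near o k)).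
have rE i : r i = srank (w (false, i)).
  by congr (srank (w (_, _))); apply: ord_inj; rewrite ord_nearE.
have r_lt k : r k < n + n by exact: srank_lt.
have r_inc k : k.+1 < n -> r k < r k.+1.
  move=> kn; have := asc (Ordinal kn).
  rewrite /descent /root_lo /root_hi /= -leqNgt leq_eqVlt.
  have -> : (false, ord_near (Ordinal kn) k) = (false, Ordinal (ltnW kn)).
    by congr pair; apply: ord_inj; rewrite ord_nearE // ltnW.
  rewrite -!rE /=; case/orP => // /eqP; rewrite -[k]/(val (Ordinal (ltnW kn))) -[k.+1]/(val (Ordinal kn)) !rE.
  by move/srank_inj/perm_inj => -[] /eqP; lia.
have r01 : n + n <= r 0 + r 1 + 1.
  have := asc o; rewrite /descent /root_lo /root_hi /= -leqNgt.
  rewrite -[(true, _)]/(ptneg (false, ord_near o 1)) hw srank_ptneg -/(r 1) -(rE o) /=; lia.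
have r_pos k : 0 < k < n -> n <= r k.
  elim: k => // -[_|k IH] kn; first by have := r_inc 0; lia.
  have := IH; have := r_inc k.+1; lia.
have sgn i : (w (false, i)).1 = (r i < n).
  by rewrite rE /srank; case: (w _) => [[] j] /=; have := ltn_ord j; lia.
have r0 : n <= r 0.
  rewrite leqNgt; apply: contra par => r0; rewrite (bigD1 o) //= sgn /= r0.
  rewrite big1 // => i io; rewrite sgn; apply/negbTE; rewrite -leqNgt r_pos // ltn_ord andbT.
  by rewrite lt0n; apply: contra io.
(* Positive entries have ranks from n on, so the reversed ranks are n decreasing numbers below n. *)
have [||_ /(_ erefl) rk] := @decreasing_bound (fun k => (n + n).-1 - r k) n n.
- by move=> k kn; case: (posnP k) => [->|k0]; have := r_pos k; lia.
- by move=> k kn; have := r_inc k kn; have := r_lt k.+1; lia.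
have wE i : w (false, i) = (false, i).
  apply: (@srank_inj n); have := rk i (ltn_ord i); have := r_lt i; rewrite rE /srank /=.
  by have := ltn_ord i; lia.
apply/permP => -[[] i]; rewrite perm1 ?wE //.
by rewrite -[(true, i)]/(ptneg (false, i)) hw wE.
Qed.

Lemma inversions1 : inversions (1 : {perm pt n})%g = set0.
Proof.
by apply/setP => -[a b]; rewrite !inE !perm1 /=; case: ltnP => //= ab; rewrite ltnNge ltnW ?andbF.
Qed.

Lemma card_inversions_word s : #|inversions (word s)| <= 2 * size s.
Proof.
elim/last_ind: s => [|s i IH]; first by rewrite inversions1 cards0.
rewrite word_rcons size_rcons; have hs := WD_neg (word_WD s).
have [d|d] := boolP (descent (word s) i).
  have := card_inversions_descent n2 hs d; lia.
rewrite card_inversions_ascent //; lia.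
Qed.

Lemma inversions_word_exists w : w \in WD n ->
  exists2 s, word s = w & #|inversions w| = 2 * size s.
Proof.
elim/ltn_ind: {w}#|inversions w| {-2}w (erefl #|inversions w|) => d IH w dE ww.
case: (pickP (descent w)) => [i di|nd]; last first.
  have -> : w = 1%g by apply: no_descent => // i; rewrite nd.
  by exists [::]; rewrite ?inversions1 ?cards0.
have := card_inversions_descent n2 (WD_neg ww) di => cE.
have /(IH #|inversions (mulc w (sgen i))|) := mulc_WD ww (sgen_WD i).
case=> [||s sw sE]; [lia | by [] |].
exists (rcons s i); first by rewrite word_rcons sw mulc_sgenK.
rewrite size_rcons; lia.
Qed.

(** A letter adds at most two inversions, and removing descents one by one yields a word that
    attains this bound. *)
Lemma lenE w : w \in WD n -> #|inversions w| = 2 * len w.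
Proof.
move=> ww; rewrite /len; case: ex_minnP => m; rewrite ww /= => /existsP[t /eqP tw] mmin.
have [s sw sE] := inversions_word_exists ww.
have := card_inversions_word t; rewrite tw size_tuple.
have : m <= size s by apply: mmin; apply/existsP; exists (in_tuple s); rewrite sw.
rewrite sE; lia.
Qed.

Lemma len_word s : len (word s) <= size s.
Proof. by have := card_inversions_word s; rewrite lenE ?word_WD //; lia. Qed.

Lemma reduced_exists w : w \in WD n -> exists s, reduced_expr s w.
Proof.
move=> ww; have [s sw] := inversions_word_exists ww; rewrite lenE // => sE.
by exists s; rewrite /reduced_expr sw eqxx; lia.
Qed.

Lemma len_descent w i : w \in WD n -> descent w i ->
  len w = (len (mulc w (sgen i))).+1.
Proof.
move=> ww d; have := card_inversions_descent n2 (WD_neg ww) d.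
rewrite !lenE ?mulc_WD ?sgen_WD //; lia.
Qed.

Lemma len_ascent w i : w \in WD n -> ~~ descent w i ->
  len (mulc w (sgen i)) = (len w).+1.
Proof.
move=> ww d; have := card_inversions_ascent n2 (WD_neg ww) d.
rewrite !lenE ?mulc_WD ?sgen_WD //; lia.
Qed.

Lemma sgenV i : (sgen i)^-1 = sgen i.
Proof. by apply/permP => a; apply: (@perm_inj _ (sgen i)); rewrite permKV sgenK. Qed.

Lemma word_rev s : word (rev s) = (word s)^-1.
Proof.
elim: s => [|i s IH]; first by rewrite invg1.
by rewrite rev_cons word_rcons IH /= /mulc invMg sgenV.
Qed.

Lemma reduced_rcons w s i : w \in WD n -> descent w i ->
  reduced_expr s (mulc w (sgen i)) -> reduced_expr (rcons s i) w.
Proof.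
move=> ww d /andP[/eqP sw /eqP sE]; rewrite /reduced_expr word_rcons sw mulc_sgenK //.
by rewrite eqxx size_rcons sE -len_descent /=.
Qed.

Lemma len_inv w : w \in WD n -> len w^-1 = len w.
Proof.
have le v : v \in WD n -> len v^-1 <= len v.
  move=> /reduced_exists[s /andP[/eqP<- /eqP<-]].
  by rewrite -word_rev (leq_trans (len_word _)) // size_rev.
move=> ww; apply/eqP; rewrite eqn_leq le //=.
by rewrite -{1}(invgK w) le ?groupV.
Qed.

(** Reversing reduced expressions exchanges their beginnings and ends. The condition on beginnings
    enters through this lemma. *)
Lemma bad_inv w : w \in WD n -> bad w -> bad w^-1.
Proof.
move=> ww [ncp hw]; split=> [[s sc sw]|s /andP[/eqP sw /eqP sE]].
  apply: ncp; exists (rev s); last by rewrite word_rev sw invgK.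
  by move=> i j; rewrite !mem_rev; apply: sc.
have rs : reduced_expr (rev s) w.
  by rewrite /reduced_expr word_rev sw invgK size_rev sE len_inv // !eqxx.
have [hb he] := hw _ rs; split=> -[i [j [t [nc e]]]]; [apply: he|apply: hb].
  exists j, i, (rev t); split; first by move/commute_sym.
  by rewrite e !rev_cons -!cats1 -catA.
exists j, i, (rev t); split; first by move/commute_sym.
by rewrite e rev_cat.
Qed.

(* x, y, z play the role of consecutive positions which sgen i and sgen j
   permute: w x > w z yields a reduced expression ending with both generators. *)
Lemma bad_lt w i j x y z : w \in WD n -> bad w -> y != z ->
  sgen i x = y -> sgen i z = z -> sgen j y = z -> sgen j x = x ->
  (forall v, neg_compat v -> descent v i = (srank (v y) < srank (v x))) ->
  (forall v, neg_compat v -> descent v j = (srank (v z) < srank (v y))) ->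
  srank (w x) < srank (w z).
Proof.
move=> ww [_ hw] yz ix iz jy jx di dj.
have iy : sgen i y = x by rewrite -ix sgenK.
have jz : sgen j z = y by rewrite -jy sgenK.
have nc : ~ commute (sgen i) (sgen j).
  by move/(congr1 (fun v : {perm pt n} => v x)); rewrite !permM ix jy jx ix => /esym/eqP; rewrite (negbTE yz).
have no k l : descent w k -> descent (mulc w (sgen k)) l -> ~ commute (sgen l) (sgen k) -> False.
  move=> dk dl nkl.
  have wk := mulc_WD ww (sgen_WD k).
  have [s rs] := reduced_exists (mulc_WD wk (sgen_WD l)).
  have [_] := hw _ (reduced_rcons ww dk (reduced_rcons wk dl rs)); apply.
  by exists l, k, s; split=> //; rewrite -!cats1 -catA.
have hn := WD_neg ww.
rewrite ltn_neqAle leqNgt; apply/andP; split; last apply/negP => zx.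
  apply/eqP => /srank_inj/perm_inj xz; apply: (negP yz).
  by apply/eqP; rewrite -ix xz iz.
(* If w y < w x, the last letter is i, and j is then a descent since w z < w x. Otherwise w z < w x
   <= w y, and the last letter is j, preceded by i. *)
have [yx|xy] := ltnP (srank (w y)) (srank (w x)).
  apply: (no i j); rewrite ?di ?dj //; last by move/commute_sym.
    by rewrite /mulc !permM iz iy.
  exact: neg_compatM (sgen_neg n2 i).
apply: (no j i) => //; rewrite ?di ?dj //; first exact: leq_trans zx xy.
  by rewrite /mulc !permM jy jx.
exact: neg_compatM (sgen_neg n2 j).
Qed.

Lemma bad_step w (i k : 'I_n) : w \in WD n -> bad w -> k = i.+2 :> nat ->
  srank (w (false, i)) < srank (w (false, k)).
Proof.
move=> ww bw ki; have jn : i.+1 < n by have := ltn_ord k; lia.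
pose j := Ordinal jn.
have loj : root_lo j = (false, i).
  by rewrite /root_lo /=; congr pair; apply: ord_inj; rewrite ord_nearE.
have lok : root_lo k = (false, j).
  by rewrite /root_lo ki /=; congr pair; apply: ord_inj; rewrite ord_nearE.
apply: (@bad_lt w j k _ (false, j)) => //.
- by rewrite xpair_eqE -val_eqE /= ki; lia.
- by rewrite -loj sgen_lo.
- by rewrite sgenE // -!val_eqE /= ki; do ![case: ifP => //]; lia.
- by rewrite -lok sgen_lo.
- by rewrite sgenE // -!val_eqE /= ki; do ![case: ifP => //]; lia.
- by move=> v _; rewrite /descent loj.
- by move=> v _; rewrite /descent lok.
Qed.

(** The points -1, 2, 3 act as consecutive positions: s_1 exchanges the first two and s_3 the last
    two. *)
Lemma bad_step0 w (i k : 'I_n) : w \in WD n -> bad w -> i = 0 :> nat -> k = 2 :> nat ->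
  srank (w (true, i)) < srank (w (false, k)).
Proof.
move=> ww bw i0 k2; pose j := Ordinal n2.
have loi : root_lo i = (true, j).
  by rewrite /root_lo i0 /=; congr pair; apply: ord_inj; rewrite ord_nearE.
have lok : root_lo k = (false, j).
  by rewrite /root_lo k2 /=; congr pair; apply: ord_inj; rewrite ord_nearE.
apply: (@bad_lt w i k _ (false, j)) => //.
- by rewrite xpair_eqE -val_eqE /= k2.
- by rewrite -[(true, i)]/(ptneg (root_hi i)) (sgen_neg n2) sgen_hi // loi.
- by rewrite sgenE // i0 /= k2.
- by rewrite -lok sgen_lo.
- by rewrite sgenE // -!val_eqE /= k2 i0.
- move=> v hv; rewrite /descent loi /root_hi -[(true, j)]/(ptneg (false, j)).
  by rewrite -[(false, i)]/(ptneg (true, i)) !hv srank_ptneg_lt.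
- by move=> v _; rewrite /descent lok.
Qed.

End Length.

(** * Words of commuting generators *)

(** Total on the naturals, as [signed_seq] requires; the default 0 occurs only for k >= n. *)
Definition wabs n (w : {perm pt n}) (k : nat) : nat :=
  oapp (fun i : 'I_n => val (w (false, i)).2) 0 (insub k).

Definition wneg n (w : {perm pt n}) (k : nat) : bool :=
  oapp (fun i : 'I_n => (w (false, i)).1) false (insub k).

Lemma wabs_ord n (w : {perm pt n}) (i : 'I_n) : wabs w i = (w (false, i)).2.
Proof. by rewrite /wabs valK. Qed.

Lemma wneg_ord n (w : {perm pt n}) (i : 'I_n) : wneg w i = (w (false, i)).1.
Proof. by rewrite /wneg valK. Qed.

Lemma rank_ofE n (w : {perm pt n}) (i : 'I_n) :
  rank_of n (wabs w) (wneg w) i = srank (w (false, i)).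
Proof. by rewrite /rank_of wabs_ord wneg_ord. Qed.

Lemma bad_signed_seq n (w : {perm pt n}) : 2 < n -> w \in WD n -> bad w ->
  signed_seq n (wabs w) (wabs w^-1) (wneg w) (wneg w^-1).
Proof.
move=> n2 ww bw; have hw := WD_neg ww; have n1 := ltnW n2.
have inv (i : 'I_n) : w^-1 (false, (w (false, i)).2) = ((w (false, i)).1, i).
  case E: (w (false, i)) => [b j] /=; apply: (@perm_inj _ w); rewrite permKV.
  case: b E => E; last by rewrite E.
  by rewrite -[(true, i)]/(ptneg (false, i)) hw E.
split.
- by move=> k kn; rewrite (wabs_ord w (Ordinal kn)).
- by move=> k kn; rewrite (wabs_ord w (Ordinal kn)) wabs_ord inv.
- by move=> k kn; rewrite (wabs_ord w (Ordinal kn)) !wneg_ord inv (wneg_ord w (Ordinal kn)).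
- move=> k kn; have kn' : k < n by lia.
  by rewrite (rank_ofE w (Ordinal kn)) (rank_ofE w (Ordinal kn')) bad_step.
- have n0 : 0 < n by lia.
  rewrite (rank_ofE w (Ordinal n2)) (rank_ofE w (Ordinal n0)) -srank_ptneg -hw.
  exact: bad_step0.
Qed.

(** For distinct positive indices, a gap of at least two means that the generators commute. Index 0
    breaks this rule, since s_1 and s_3 do not commute, so positivity is asked for separately. *)
Definition spread n (s : seq 'I_n) :=
  uniq s /\ {in s &, forall i j : 'I_n, i < j -> i.+1 < j}.

Lemma spread_rcons n (s : seq 'I_n) i : spread (rcons s i) ->
  [/\ spread s, i \notin s & forall j : 'I_n, j \in s -> j.+1 < i \/ i.+1 < j].
Proof.
case=> []; rewrite rcons_uniq => /andP[ni us] h; split=> //.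
  by split=> // j k js ks; apply: h; rewrite mem_rcons inE ?js ?ks orbT.
move=> j js; have ir : i \in rcons s i by rewrite mem_rcons mem_head.
have jr : j \in rcons s i by rewrite mem_rcons inE js orbT.
have : i != j by apply: contraNneq ni => ->.
by rewrite -val_eqE neq_ltn => /orP[] => /h H; [right|left]; apply: H.
Qed.

Section SpreadWords.

Variables (n : nat) (n2 : 1 < n).
Implicit Types (i j k : 'I_n) (s : seq 'I_n) (u w x : {perm pt n}).

Lemma word_fix s b k : (forall j, j \in s -> [&& 0 < j, j != k :> nat & j != k.+1 :> nat]) ->
  word s (b, k) = (b, k).
Proof.
elim: s => [|i s IH] far; first by rewrite perm1.
rewrite /= /mulc permM IH => [|j js]; last by apply: far; rewrite inE js orbT.
have /and3P[i0 ik ik1] := far i (mem_head _ _).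
by rewrite sgenE // (gtn_eqF i0) -val_eqE /= !ifN //; lia.
Qed.

Lemma word_spread s b j : spread s -> (forall i, i \in s -> 0 < i) -> j \in s ->
  word s (b, j) = (b, ord_near j j.-1) /\ word s (b, ord_near j j.-1) = (b, j).
Proof.
elim/last_ind: s => [|s i IH] //= /spread_rcons[ss ni far] pos.
have pos' k : k \in s -> 0 < k by move=> ks; apply: pos; rewrite mem_rcons inE ks orbT.
have i0 : 0 < i by apply: pos; rewrite mem_rcons mem_head.
have ep := val_ord_near_pred n2.
have lo (k : 'I_n) : 0 < k -> root_lo k = (false, ord_near k k.-1).
  by move=> k0; rewrite /root_lo (gtn_eqF k0).
rewrite mem_rcons inE word_rcons /mulc !permM !(sgenE n2 i) (gtn_eqF i0) /= => /predU1P[->|js].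
  rewrite eqxx -val_eqE /= ep eqxx.
  rewrite ifN; last by lia.
  by rewrite !word_fix // => k ks; have := far k ks; have := pos' k ks; rewrite ?ep; lia.
have j0 := pos' j js; have fj := far j js.
by rewrite -!val_eqE /= !ep !ifN; [exact: IH | lia..].
Qed.

(** Each new letter i is an ascent: the earlier letters do not touch i - 1 and i, and x fixes
    both. *)
Lemma len_mul_spread x s m : x \in WD n -> (forall b k, m <= k -> x (b, k) = (b, k)) ->
  spread s -> (forall i, i \in s -> m < i) -> len (mulc x (word s)) = len x + size s.
Proof.
move=> xW xfix; elim/last_ind: s => [|s i IH] /=.
  by rewrite addn0 /mulc mul1g.
move=> /spread_rcons[ss ni far] pos.
have pos' k : k \in s -> m < k by move=> ks; apply: pos; rewrite mem_rcons inE ks orbT.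
have mi : m < i by apply: pos; rewrite mem_rcons mem_head.
have i0 : 0 < i by lia.
have -> : mulc x (word (rcons s i)) = mulc (mulc x (word s)) (sgen i).
  by rewrite word_rcons /mulc mulgA.
rewrite len_ascent ?mulc_WD ?word_WD //.
  by rewrite IH // size_rcons addnS.
have ep := val_ord_near_pred n2 i.
rewrite /descent /root_lo /root_hi (gtn_eqF i0) /mulc !permM !word_fix.
- by rewrite !xfix ?ep /srank /= ?ep; lia.
- by move=> k ks; have := far k ks; have := pos' k ks; rewrite ?ep; lia.
- move=> k ks; have := far k ks; have := pos' k ks.
  have : k != i by apply: contraNneq ni => <-.
  by rewrite -val_eqE /=; lia.
Qed.

Lemma spread_commute s i j : spread s -> (forall i, i \in s -> 0 < i) ->
  i \in s -> j \in s -> commute (sgen i) (sgen j).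
Proof.
move=> [us h] pos; wlog ij : i j / i < j => [H si sj|si sj].
  have [ij|ji|/val_inj->//] := ltngtP i j; first exact: H.
  by apply/commute_sym/H.
have i0 := pos i si; have j0 := pos j sj; have gap := h i j si sj ij.
apply/permP => -[b k]; rewrite !permM !sgenE // (gtn_eqF i0) (gtn_eqF j0) /=.
have ei := val_ord_near_pred n2 i; have ej := val_ord_near_pred n2 j.
congr pair; apply: ord_inj; rewrite -!val_eqE /=.
by do ![case: ifP => /=]; rewrite ?ei ?ej; lia.
Qed.

(** The last letter i of a reduced expression is a descent. Index 0 is none, as u changes no sign;
    nor is i <= m, as u fixes i - 1 and cannot send i below i. Removing the letter preserves the
    hypotheses. *)
Lemma supp_unsigned u m (t : seq 'I_n) : (forall b k, (u (b, k)).1 = b) ->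
  (forall b k, k < m -> u (b, k) = (b, k)) -> reduced_expr t u ->
  forall i, i \in t -> m < i.
Proof.
elim/last_ind: t u => [|t i IH] u us ufix // /andP[/eqP tu /eqP tl] l.
have uW : u \in WD n by rewrite -tu word_WD.
have vE : word t = mulc u (sgen i) by rewrite -tu word_rcons mulc_sgenK.
have di : descent u i.
  apply: contraT => di; have := len_ascent n2 uW di; rewrite -vE -tl size_rcons.
  by have := len_word n2 t; lia.
have i0 : 0 < i.
  rewrite lt0n; apply: contraL di => i0; rewrite /descent /root_lo i0 /root_hi.
  rewrite /srank !us -leqNgt; lia.
have mi : m < i.
  rewrite ltnNge; apply: contraL di => im.
  rewrite /descent /root_lo /root_hi (gtn_eqF i0) (ufix _ (ord_near _ _)) ?val_ord_near_pred //; last by lia.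
  rewrite -leqNgt /srank us /= val_ord_near_pred // leq_add2l.
  apply: leq_trans (leq_pred _) _; have [//|lt] := leqP i (u (false, i)).2.
  have /perm_inj e : u (u (false, i)) = u (false, i).
    by case E: (u _) lt => [c k] /= lt; rewrite ufix //; lia.
  by rewrite e ltnn in lt.
rewrite mem_rcons inE => /predU1P[->//|]; apply: (IH (mulc u (sgen i))).
- move=> b k; rewrite /mulc permM sgenE // (gtn_eqF i0) /=; exact: us.
- move=> b k km; rewrite /mulc permM sgenE // (gtn_eqF i0) /= !ifN ?ufix //; [lia|].
  by rewrite -val_eqE /=; lia.
by rewrite /reduced_expr vE eqxx; have := len_descent n2 uW di; rewrite -vE -tl size_rcons => -[->] /=.
Qed.

End SpreadWords.

(** The larger member i of a swapped pair is recorded because [sgen i] swaps i - 1 and i. *)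
Definition swap_word n (f : nat -> nat) r : seq 'I_n :=
  [seq i : 'I_n <- enum 'I_n | (r <= i) && (f i < i)].

(** Two neighbours i and i + 1 cannot both be letters: f (i + 1) = i would give f i = i + 1. So the
    letters act on disjoint pairs. *)
Lemma swap_wordP n f r : 1 < n -> 0 < r -> (forall i, i < n -> f i < n) ->
  (forall i, r <= i -> i < n -> [/\ r <= f i, f i <= i.+1, i <= (f i).+1 & f (f i) = i]) ->
  [/\ spread (swap_word n f r), forall i, i \in swap_word n f r -> r < i
    & forall b k, word (swap_word n f r) (b, k) =
        (b, ord_near k (if r <= k then f k else k))].
Proof.
move=> n2 r0 fn fr; set s := swap_word n f r.
have sE (i : 'I_n) : (i \in s) = (r <= i) && (f i < i).
  by rewrite mem_filter mem_enum andbT.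
have ss : spread s.
  split; first by rewrite filter_uniq ?enum_uniq.
  move=> i j; rewrite !sE => /andP[ri fi] /andP[rj fj] ij.
  have [_ _ jf ffj] := fr j rj (ltn_ord j).
  rewrite ltn_neqAle ij andbT; apply/eqP => ji.
  have fji : f j = i by lia.
  by move: fi; rewrite -fji ffj; lia.
have rs (i : 'I_n) : i \in s -> r < i.
  by rewrite sE => /andP[ri fi]; have [] := fr i ri (ltn_ord i); lia.
have s0 (i : 'I_n) : i \in s -> 0 < i by move/rs; lia.
split=> // b k; have [ks|ks] := boolP (k \in s).
  have [-> _] := word_spread n2 b ss s0 ks.
  move: (ks); rewrite sE => /andP[rk fk]; rewrite rk.
  have [_ _ kf _] := fr k rk (ltn_ord k).
  by congr (b, ord_near k _); lia.
have [rk|kr] := leqP r k; last first.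
  rewrite word_fix // => [|j js]; last by have := rs j js; lia.
  by congr pair; apply: ord_inj; rewrite ord_nearE.
have [rf fk kf ffk] := fr k rk (ltn_ord k).
move: ks; rewrite sE rk /= -leqNgt leq_eqVlt => /predU1P[fkk|kfk]; last first.
  have kn : k.+1 < n by have := fn k (ltn_ord k); lia.
  pose j := Ordinal kn; have fkE : f k = k.+1 by lia.
  have js : j \in s by rewrite sE /= -fkE ffk; lia.
  have := (word_spread n2 b ss s0 js).2.
  have -> : ord_near j j.-1 = k by apply: ord_inj; rewrite ord_nearE /= ?ltn_ord.
  by move=> ->; rewrite fkE; congr pair; apply: ord_inj; rewrite [RHS]ord_nearE.
rewrite -fkk word_fix // => [|j js].
  by congr pair; apply: ord_inj; rewrite ord_nearE.
have := s0 j js; move: js; rewrite sE => /andP[rj fj] -> /=.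
have [_ _ jf ffj] := fr j rj (ltn_ord j).
apply/andP; split; apply/eqP => jk; first by move: fj; rewrite jk -fkk; lia.
have fjk : f j = k by lia.
by move: ffj; rewrite fjk -fkk; lia.
Qed.

(** * The element w_m and the factorization *)

Lemma neg_compat_ext n (v w : {perm pt n}) : neg_compat v -> neg_compat w ->
  (forall k, v (false, k) = w (false, k)) -> v = w.
Proof.
move=> hv hw h; apply/permP => -[[] k]; last exact: h.
by rewrite -[(true, k)]/(ptneg (false, k)) hv hw h.
Qed.

Lemma wm_neg_compat n m : neg_compat (wm n m).
Proof. by case=> b k; rewrite !permE /wm_fun /ptneg /= addNb. Qed.

Lemma wm_double n p (k : 'I_n) : wm n p.*2 (false, k) =
  (if k == 0 :> nat then odd p else odd k && (k < p.*2),
   ord_near k (if odd k && (k < p.*2) then p.*2 - k else k)).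
Proof.
rewrite permE /wm_fun /= doubleK /wm_neg /wm_abs doubleK eqSS /= negbK.
by congr (_, ord_near k _); case: ifP => // /andP[_ kp]; lia.
Qed.

Lemma parity_blocks m p :
  \big[addb/false]_(0 <= i < m) (odd i && (i < p.*2)) = odd (minn m p.*2)./2.
Proof.
elim: m => [|m IH]; first by rewrite big_geq // min0n.
rewrite big_nat_recr //= IH; have [pm|mp] := leqP p.*2 m.
  by rewrite andbF addbF !(minn_idPr _) // leqW.
rewrite andbT (minn_idPl mp) /= uphalf_half oddD.
by rewrite addbC; case: (odd m).
Qed.

Lemma WD_parity n (w : {perm pt n}) : w \in WD n ->
  \big[addb/false]_(0 <= i < n) wneg w i = false.
Proof.
case/WDP=> _ /negbTE par; rewrite big_mkord -[RHS]par.
by apply: eq_bigr => i _; rewrite wneg_ord.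
Qed.

Lemma commute_far n (i j : 'I_n) : 1 < n -> i <= 1 -> 2 < j ->
  commute (sgen i) (sgen j).
Proof.
move=> n2 i1 j2; have j0 : (j == 0 :> nat) = false by lia.
have ei := val_ord_near_pred n2 i; have ej := val_ord_near_pred n2 j.
have e1 := val_ord_near1 n2 i.
apply/permP => -[b k]; rewrite !permM !sgenE // j0; case: (eqVneq (i : nat) 0) => i0 /=.
  rewrite -!val_eqE /=.
  by do ![case: ifP => /=]; rewrite ?ei ?ej ?e1; try lia; move=> *; congr pair; apply: ord_inj; lia.
congr pair; apply: ord_inj; rewrite -!val_eqE /=.
by do ![case: ifP => /=]; rewrite ?ei ?ej; lia.
Qed.

Lemma signed_image n (w : {perm pt n}) (k : 'I_n) :
  w (false, k) = (wneg w k, ord_near k (wabs w k)).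
Proof.
rewrite [LHS]surjective_pairing wneg_ord wabs_ord; congr pair.
by apply: ord_inj; rewrite ord_nearE.
Qed.

Lemma ord_near_eq n (i j : 'I_n) a b : a = b -> a < n -> ord_near i a = ord_near j b.
Proof. by move=> <- an; apply: ord_inj; rewrite !ord_nearE. Qed.

Theorem theorem2p28 (n : nat) (hn : 4 <= n) (w : {perm pt n})
    (hw : w \in WD n) (hbad : bad w) :
  exists (m : nat) (u : {perm pt n}),
    [/\ m <= n,
        w = mulc (wm n m) u,
        len w = len (wm n m) + len u,
        commuting_product u
      & supp u \subset [set i : 'I_n | m + 2 <= i.+1]].
Proof.
have n2 : 2 < n by lia.
have n1 : 1 < n by lia.
have n0 : 0 < n by lia.
have S := bad_signed_seq n2 hw hbad.
have S' : signed_seq n (wabs w^-1) (wabs w) (wneg w^-1) (wneg w).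
  have := bad_signed_seq n2 (groupVr hw) (bad_inv n1 hw hbad).
  by rewrite invgK.
have wc := WD_neg hw.
have par := WD_parity hw.
have Flt := ss_lt S.
have [F0|F0] := posnP (wabs w 0); last first.
  have [{}F0 F1 pos sh] := shape_moved_first n2 S S' F0.
  have [ss s2 sE] := swap_wordP n1 (isT : 0 < 2) Flt (shuffle_swap sh).
  set s := swap_word _ _ _ in ss s2 sE.
  (* Only w(1) and w(2) can be negative, and the number of negative entries is even. *)
  have e01 : wneg w 1 = wneg w 0.
    move: par; rewrite big_ltn // big_ltn // big_nat big1.
      by case: (wneg w 0); case: (wneg w 1).
    by move=> i /andP[i2 i_n]; apply/negbTE/pos.
  pose o := Ordinal n0; pose o1 := Ordinal n1.
  (* On the first two positions w is (-2, -1) or (2, 1), that is s_1 or s_2. It commutes with the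
     remaining letters, which start at s_4, so w would be a product of commuting generators. *)
  pose j := if wneg w 0 then o else o1.
  have j1 : j <= 1 by rewrite /j; case: ifP.
  case: hbad => ncp _; case: ncp; exists (j :: s).
    have s0 (i : 'I_n) : i \in s -> 0 < i by move/s2; lia.
    move=> a b; rewrite !inE => /predU1P[->|sa] /predU1P[->|sb] //.
    - exact: commute_far (s2 _ sb).
    - by apply: commute_sym; exact: commute_far (s2 _ sa).
    - exact: (spread_commute n1 ss s0).
  apply: neg_compat_ext => // [|k].
    by apply: WD_neg; apply: word_WD.
  rewrite /= /mulc permM sE signed_image.
  have [k2|k2] := leqP 2 k.
    rewrite (negbTE (pos k k2 (ltn_ord k))) sgenE //.
    have [rF _ _ _] := shuffle_swap sh k2 (ltn_ord k).
    rewrite -!val_eqE /= ord_nearE ?Flt //.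
    by case: ifP => _; rewrite !ifN //; lia.
  have -> : ord_near k k = k by apply: ord_inj; rewrite ord_nearE.
  have [ke|ke] : k = o \/ k = o1.
    by case: k k2 => -[|[|k]] //= ? _; [left|right]; apply: ord_inj.
    rewrite ke /= F0 /j; case: (wneg w 0); rewrite sgenE //=.
    by congr pair; apply: ord_inj; rewrite ord_nearE.
  rewrite ke /= F1 e01 /j; case: (wneg w 0); rewrite sgenE //=.
  by congr pair; apply: ord_inj; rewrite ord_nearE.
have [p [pn odds pos fixed sh]] := shape_fixed_first n2 S S' F0.
set r := maxn 1 p.*2 in sh.
have r0 : 0 < r by rewrite /r; lia.
have [ss sr sE] := swap_wordP n1 r0 Flt (shuffle_swap sh).
set s := swap_word _ _ _ in ss sr sE.
have s0 (i : 'I_n) : i \in s -> 0 < i by move/sr; lia.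
(* Apart from w(1) there are exactly p negative entries, so the parity condition determines the sign
   of w(1). *)
have E0 : wneg w 0 = odd p.
  have := parity_blocks n p; rewrite (minn_idPr pn) doubleK => <-.
  suff e : \big[addb/false]_(1 <= i < n) wneg w i =
           \big[addb/false]_(1 <= i < n) (odd i && (i < p.*2)).
    rewrite [RHS]big_ltn //=; move: par; rewrite big_ltn // e.
    by case: (wneg w 0); case: (\big[_/_]_(_ <= _ < _) _).
  apply: eq_big_nat => i /andP[i0 i_n].
  have [/andP[io ip]|nip] := boolP (odd i && (i < p.*2)).
    have [|] := odds i./2; first by lia.
    by rewrite (_ : i./2.*2.+1 = i) //; lia.
  by apply/negbTE/pos => //; rewrite /outer; lia.
have wE : w = mulc (wm n p.*2) (word s).
  apply: neg_compat_ext => // [|k].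
    by apply: neg_compatM; [apply: wm_neg_compat | apply/WD_neg/word_WD].
  rewrite /mulc permM sE signed_image.
  (* From r on, the word moves k within the range that w_m fixes; below r, the word fixes k and w_m
     alone acts. *)
  have [rk|kr] := leqP r k.
    have [rF _ _ _] := shuffle_swap sh rk (ltn_ord k).
    have kF := Flt k (ltn_ord k).
    have Fp : (wabs w k < p.*2) = false by lia.
    rewrite wm_double ord_nearE // Fp andbF.
    rewrite ifN; last by lia.
    rewrite (negbTE (pos k _ _)) //; last by rewrite /outer; lia.
    by congr pair; apply: ord_inj; rewrite !ord_nearE.
  have -> : ord_near k k = k by apply: ord_inj; rewrite ord_nearE.
  rewrite wm_double; case: (eqVneq (k : nat) 0) => [k0|k0].
    by rewrite k0 E0 F0 /=; congr pair; apply: ord_near_eq.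
  have kp : k < p.*2 by lia.
  rewrite kp andbT; have [ko|ke] := boolP (odd k).
    have [|] := odds k./2; first by lia.
    rewrite (_ : k./2.*2.+1 = k) => [-> ->|]; last by lia.
    by congr pair; apply: ord_near_eq; lia.
  rewrite fixed // (negbTE (pos k _ _)) //; rewrite /outer; lia.
(* The group contains w and the word, hence also the remaining factor. *)
have wmW : wm n p.*2 \in WD n.
  rewrite -(groupMl _ (word_WD s)) /=.
  by move: hw; rewrite {1}wE.
have wmfix b (k : 'I_n) : r <= k -> wm n p.*2 (b, k) = (b, k).
  move=> rk; have e : wm n p.*2 (false, k) = (false, k).
    have kp : (k < p.*2) = false by lia.
    rewrite wm_double kp andbF.
    by rewrite ifN; [congr pair; apply: ord_inj; rewrite ord_nearE | lia].
  by case: b => //; rewrite -[(true, k)]/(ptneg (false, k)) wm_neg_compat e.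
have len_s : len (word s) = size s.
  have := @len_mul_spread n n1 1 s r (group1 _) _ ss sr.
  rewrite /mulc mulg1 => -> => [|b k _]; last by rewrite perm1.
  by have := len_word n1 [::]; rewrite /= leqn0 => /eqP ->.
exists p.*2, (word s); split=> //.
- by rewrite {1}wE (len_mul_spread n1 wmW wmfix ss sr) len_s.
- exists s => // i j si sj; exact: (spread_commute n1 ss s0).
apply/subsetP => i; rewrite !inE => /existsP[t /andP[rt it]].
(* Index i stands for s_(i+1), so m <= r < i is the required bound m + 2 <= i + 1. *)
have /(_ i it) : forall i, i \in val t -> r < i.
  apply: (supp_unsigned n1 _ _ rt) => b k; first by rewrite sE.
  move=> kr; rewrite sE leqNgt kr; congr pair; apply: ord_inj.
  by rewrite ord_nearE.
by lia.
Qed.
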